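(* Fix any constant $\kappa>0$. For all sufficiently large $n$, there exists a pair of neighboring graphs $G=(V,E,w)$ and $G'=(V,E',w')$ on $n$ vertices with $\lambda(G)\ge 2+\kappa$ such that $$\max_{u,v\in V,\,u\ne v}\big|R_{\mathsf{eff}}(u,v)-R'_{\mathsf{eff}}(u,v)\big|=\Theta\!\left(\frac{1}{\lambda^2(G)}\right),$$ where $R_{\mathsf{eff}}$ and $R'_{\mathsf{eff}}$ denote effective resistances in $G$ and $G'$ respectively.
   Context: Graphs on $n$ vertices are identified with weight vectors in $\mathbb{R}_+^{\binom n2}$; $G,G'$ are neighboring if $\|w-w'\|_0\le1$ and $\|w-w'\|_\infty\le1$. $L_G=D_G-A_G$ is the weighted Laplacian, $L_G^\dagger$ its Moore–Penrose pseudoinverse, and $\lambda(G)$ the smallest non-zero eigenvalue of $L_G$. For $u\ne v$, $b_{u,v}=\mathbf e_u-\mathbf e_v$ and $R_{\mathsf{eff}}(u,v)=b_{u,v}^\top L_G^\dagger b_{u,v}$. *)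

(* Defs.v *)
From HB Require Import structures.
From mathcomp Require Import all_boot all_order all_algebra.
From mathcomp Require Import boolp classical_sets reals.

Set Implicit Arguments.
Unset Strict Implicit.
Unset Printing Implicit Defensive.

Import Order.TTheory GRing.Theory Num.Theory.
Local Open Scope ring_scope.

Definition is_pseudoinverse (R : realType) (m n : nat)
    (A : 'M[R]_(m, n)) (X : 'M[R]_(n, m)) : Prop :=
  [/\ A *m X *m A = A, X *m A *m X = X,
      (A *m X)^T = A *m X & (X *m A)^T = X *m A].

(* The default 0 of xget is never reached: see pseudoinverseP and
   pseudoinverse_unique below. *)
Definition pseudoinverse (R : realType) (m n : nat)
    (A : 'M[R]_(m, n)) : 'M[R]_(n, m) :=
  xget 0 [set X | is_pseudoinverse A X]%classic.

Definition is_smallest_nonzero_eigenvalue (R : realType) (n : nat)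
    (A : 'M[R]_n) (a : R) : Prop :=
  [/\ eigenvalue A a, a != 0 &
      forall b : R, eigenvalue A b -> b != 0 -> a <= b].

Definition edge (n : nat) := {e : {set 'I_n} | #|e| == 2}.

Record wgraph (R : realType) (n : nat) := WGraph {
  weight :> {ffun edge n -> R};
  weight_ge0 : forall e : edge n, 0 <= weight e
}.

(* The two conjuncts are ||w - w'||_0 <= 1 and ||w - w'||_oo <= 1. *)
Definition neighboring (R : realType) (n : nat) (G G' : wgraph R n) : Prop :=
  (#|[pred e : edge n | weight G e != weight G' e]| <= 1)%N /\
  \big[Num.max/0]_(e : edge n) `|weight G e - weight G' e| <= 1.

(* [insub] fails, and the entry is 0, exactly when u = v. *)
Definition adjacency (R : realType) (n : nat) (G : wgraph R n) : 'M[R]_n :=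
  \matrix_(u, v) oapp (weight G) 0 (insub [set u; v]%SET : option (edge n)).

Definition degree_mx (R : realType) (n : nat) (G : wgraph R n) : 'M[R]_n :=
  diag_mx (\row_u \sum_v adjacency G u v).

Definition laplacian (R : realType) (n : nat) (G : wgraph R n) : 'M[R]_n :=
  degree_mx G - adjacency G.

(* Equal to 0 when the Laplacian has no nonzero eigenvalue, that is, when G has
   no edge. *)
Definition lambda (R : realType) (n : nat) (G : wgraph R n) : R :=
  xget 0 [set a | is_smallest_nonzero_eigenvalue (laplacian G) a]%classic.

Definition bvec (R : realType) (n : nat) (u v : 'I_n) : 'cV[R]_n :=
  delta_mx u 0 - delta_mx v 0.

Definition Reff (R : realType) (n : nat) (G : wgraph R n) (u v : 'I_n) : R :=
  ((bvec R u v)^T *m pseudoinverse (laplacian G) *m bvec R u v) 0 0.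

(* The terms are nonnegative, so the default 0 does not affect the maximum as
   soon as n >= 2. *)
Definition max_Reff_diff (R : realType) (n : nat) (G G' : wgraph R n) : R :=
  \big[Num.max/0]_(p : 'I_n * 'I_n | p.1 != p.2)
    `|Reff G p.1 p.2 - Reff G' p.1 p.2|.

Lemma gram_unit (R : realType) (r n : nat) (B : 'M[R]_(r, n)) :
  row_free B -> B *m B^T \in unitmx.
Proof.
move=> fB; rewrite -row_free_unit; apply: inj_row_free => v vBB0.
apply: (row_free_inj fB); rewrite mul0mx.
have : (v *m B *m (v *m B)^T) 0 0 = 0.
  by rewrite trmx_mul mulmxA -(mulmxA v) vBB0 mul0mx mxE.
move: (v *m B) => w; rewrite mxE => /eqP; rewrite psumr_eq0 => [/allP h|i _]; last first.
  by rewrite mxE -expr2 sqr_ge0.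
apply/rowP => i; rewrite [RHS]mxE; have := h i (mem_index_enum i).
by rewrite mxE -expr2 sqrf_eq0 => /eqP.
Qed.

Lemma is_pseudoinverse_ex (R : realType) (m n : nat) (A : 'M[R]_(m, n)) :
  exists X, is_pseudoinverse A X.
Proof.
have fC : row_free (col_base A)^T.
  by rewrite /row_free mxrank_tr; exact: col_base_full.
have := gram_unit fC => {fC}; have := gram_unit (row_base_free A); rewrite trmxK.
have := mulmx_base A; move: (\rank A) (col_base A) (row_base A) => r C F <- uF uC.
set iF := invmx (F *m F^T); set iC := invmx (C^T *m C).
have tF : iF^T = iF by rewrite /iF trmx_inv trmx_mul trmxK.
have tC : iC^T = iC by rewrite /iC trmx_inv trmx_mul trmxK.
exists (F^T *m iF *m iC *m C^T).
have AX : C *m F *m (F^T *m iF *m iC *m C^T) = C *m iC *m C^T.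
  by rewrite !mulmxA -(mulmxA C F) -(mulmxA C _ iF) mulmxV // mulmx1.
have XA : F^T *m iF *m iC *m C^T *m (C *m F) = F^T *m iF *m F.
  by rewrite !mulmxA -(mulmxA _ C^T C) -(mulmxA _ iC) mulVmx // mulmx1.
split; rewrite ?AX ?XA.
- by rewrite mulmxA -(mulmxA _ C^T C) -(mulmxA C iC) mulVmx // mulmx1.
- by rewrite !mulmxA -(mulmxA _ F F^T) -(mulmxA F^T iF) mulVmx // mulmx1.
- by rewrite !trmx_mul trmxK tC mulmxA.
- by rewrite !trmx_mul trmxK tF mulmxA.
Qed.

Lemma pseudoinverseP (R : realType) (m n : nat) (A : 'M[R]_(m, n)) :
  is_pseudoinverse A (pseudoinverse A).
Proof.
exact: (@xgetPex _ 0 [set X | is_pseudoinverse A X]%classic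
          (is_pseudoinverse_ex A)).
Qed.

Lemma is_pseudoinverse_unique (R : realType) (m n : nat)
    (A : 'M[R]_(m, n)) (X Y : 'M[R]_(n, m)) :
  is_pseudoinverse A X -> is_pseudoinverse A Y -> X = Y.
Proof.
move=> [aX xX tX sX] [aY xY tY sY].
have eX : A *m X = A *m Y.
  by rewrite -tX -{1}aY -(mulmxA (A *m Y)) trmx_mul tX tY mulmxA aX.
have eY : X *m A = Y *m A.
  rewrite -sX -{1}aY -(mulmxA A Y) (mulmxA X) trmx_mul sX sY.
  by rewrite -(mulmxA Y) (mulmxA A X) aX.
by rewrite -xX eY -mulmxA eX mulmxA xY.
Qed.

Lemma pseudoinverse_unique (R : realType) (m n : nat)
    (A : 'M[R]_(m, n)) (X : 'M[R]_(n, m)) :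
  is_pseudoinverse A X -> pseudoinverse A = X.
Proof. exact/is_pseudoinverse_unique/pseudoinverseP. Qed.

Lemma lambda_unique (R : realType) (n : nat) (G : wgraph R n) (a : R) :
  is_smallest_nonzero_eigenvalue (laplacian G) a -> lambda G = a.
Proof.
move=> aG; apply: xget_unique => //= b [eb b0 bmin].
case: aG => ea a0 amin; apply/eqP; rewrite eq_le.
by rewrite bmin // amin.
Qed.

(* Main.v *)
(* The witness is G = K_n with unit weights, and G' is K_n with one edge {s, t}
   raised to weight 2.  With J the all-ones matrix and P := 1 - J / n the
   projection orthogonal to it, L_G = n P, so lambda(G) = n and L_G^+ = P / n.
   With b := e_s - e_t one has P b = b and L_G' = n P + b b^T, so by
   Sherman-Morrison L_G'^+ = (P - b b^T / (n + 2)) / n.  Hence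
   R_eff(u, v) - R'_eff(u, v) = <b_uv, b>^2 / (n (n + 2)), whose maximum,
   reached at (s, t), is 4 / (n (n + 2)). *)
Require Import Defs.
From mathcomp Require Import all_boot all_order all_algebra.
From mathcomp Require Import reals.
From mathcomp Require Import ring lra.

Import Order.TTheory GRing.Theory Num.Theory.
Local Open Scope ring_scope.

Set Implicit Arguments.
Unset Strict Implicit.
Unset Printing Implicit Defensive.

(** * The two graphs and their Laplacians *)

Definition complete_graph (R : realType) (n : nat) : wgraph R n :=
  @WGraph R n [ffun=> 1] (fun e => ltac:(by rewrite ffunE)).

(** Raises the weight of the edge [{s, t}] by one. For [s = t] no two-element set matches, so the
    weights stay as they are. *)
Definition add_edge (R : realType) (n : nat) (G : wgraph R n) (s t : 'I_n) :
    wgraph R n :=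
  @WGraph R n [ffun e => G e + (val e == [set s; t]%SET)%:R]
    (fun e => ltac:(by rewrite ffunE addr_ge0 // weight_ge0)).

Lemma neighboring_add_edge (R : realType) (n : nat) (G : wgraph R n)
    (s t : 'I_n) :
  neighboring G (add_edge G s t).
Proof.
split.
  apply/card_le1_eqP => e f; rewrite !inE !ffunE.
  have [ee _|_] := eqVneq (val e) [set s; t]%SET; last by rewrite addr0 eqxx.
  have [fe _|_] := eqVneq (val f) [set s; t]%SET; last by rewrite addr0 eqxx.
  by apply: val_inj; rewrite ee fe.
apply: (big_ind (fun x => x <= 1)) => // [x y x1 y1|e _].
  by rewrite ge_max x1 y1.
by rewrite ffunE opprD addrA subrr sub0r normrN normr_nat lern1 leq_b1.
Qed.

Lemma adjacency_complete_graph (R : realType) (n : nat) (u v : 'I_n) :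
  adjacency (complete_graph R n) u v = (u != v)%:R.
Proof.
rewrite mxE; case: insubP => [e|] /=; rewrite cards2.
  by rewrite ffunE; case: (eqVneq u v).
by case: (eqVneq u v).
Qed.

Lemma adjacency_add_edge (R : realType) (n : nat) (G : wgraph R n)
    (s t : 'I_n) :
  s != t ->
  adjacency (add_edge G s t) = adjacency G + (delta_mx s t + delta_mx t s).
Proof.
move=> st; apply/matrixP => u v; rewrite !mxE.
(* [insub] fails only on the diagonal, where both delta matrices vanish because [s != t]. *)
case: insubP => [e|] /=; rewrite cards2; last first.
  case: (eqVneq u v) => // <- _; rewrite add0r.
  by case: (eqVneq u s) => [->|_] /=; rewrite ?(negPf st) ?andbF addr0.
case: (eqVneq u v) => // uv _ ve; rewrite ffunE ve -natrD; congr (_ + _%:R).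
have [E|E] := eqVneq [set u; v]%SET [set s; t]%SET.
  have : u \in [set s; t]%SET by rewrite -E set21.
  have : v \in [set s; t]%SET by rewrite -E set22.
  rewrite !inE => /orP[] /eqP vE /orP[] /eqP uE; move: uv;
    by rewrite uE vE ?eqxx ?(eq_sym t s) ?(negPf st).
have /negPf-> : ~~ ((u == s) && (v == t)).
  by apply: contraNN E => /andP[/eqP-> /eqP->].
have /negPf-> // : ~~ ((u == t) && (v == s)).
by apply: contraNN E => /andP[/eqP-> /eqP->]; rewrite setUC.
Qed.

Lemma laplacian_add_edge (R : realType) (n : nat) (G : wgraph R n)
    (s t : 'I_n) :
  s != t ->
  laplacian (add_edge G s t) = laplacian G + bvec R s t *m (bvec R s t)^T.
Proof.
move=> st; rewrite /laplacian /degree_mx adjacency_add_edge //.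
apply/matrixP => u v; rewrite !mxE.
under eq_bigr do rewrite mxE.
rewrite big_split /= big_ord1 !mxE !eqxx !andbT.
have -> : \sum_i (delta_mx s t + delta_mx t s : 'M[R]_n) u i
          = (u == s)%:R + (u == t)%:R.
  under eq_bigr do rewrite !mxE.
  rewrite big_split /=; congr (_ + _).
    by rewrite (bigD1 t) //= eqxx andbT big1 ?addr0 // => i /negPf ->; rewrite andbF.
  by rewrite (bigD1 s) //= eqxx andbT big1 ?addr0 // => i /negPf ->; rewrite andbF.
(* The diagonal gains 1 at [s] and at [t]; off it, only the entries [(s, t)] and [(t, s)] change, by
   -1. These are the entries of [b b^T]. *)
have [<-|uv] := eqVneq u v.
  have [->|_] := eqVneq u s; first by rewrite (negPf st) /=; ring.
  by case: (u == t) => /=; ring.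
have [us|_] := eqVneq u s.
  by rewrite -us (eq_sym v u) (negPf uv) us (negPf st); case: (v == t) => /=; ring.
have [ut|_] := eqVneq u t; last by rewrite /=; ring.
by rewrite -ut (eq_sym v u) (negPf uv); case: (v == s) => /=; ring.
Qed.

Lemma laplacian_complete_graph (R : realType) (n : nat) :
  laplacian (complete_graph R n) = n%:R%:M - const_mx 1.
Proof.
apply/matrixP => u v; rewrite [LHS]mxE [X in _ + X]mxE.
rewrite adjacency_complete_graph !mxE.
under eq_bigr do rewrite adjacency_complete_graph.
have -> : \sum_(i < n) (u != i)%:R = n%:R - 1 :> R.
  have -> : n%:R = \sum_(i < n) 1 :> R by rewrite sumr_const card_ord.
  rewrite (bigD1 u) //= eqxx add0r [in RHS](bigD1 u) //= [RHS]addrC addKr.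
  by apply: eq_bigr => i; rewrite eq_sym => ->.
by case: eqVneq => _; rewrite ?mulr0n ?mulr1n; ring.
Qed.

(** * Pseudoinverses of symmetric matrices and the projection orthogonal to the all-ones vector *)

Lemma is_pseudoinverse_sym (R : realType) (n : nat) (A X P : 'M[R]_n) :
  A^T = A -> X^T = X -> P^T = P -> A *m X = P -> P *m A = A -> P *m X = X ->
  is_pseudoinverse A X.
Proof.
move=> tA tX tP AX PA PX.
(* Transposing [A X = P] gives [X A = P], so the four Penrose equations become the hypotheses on
   [P]. *)
have XA : X *m A = P by rewrite -tP -AX trmx_mul tA tX.
by split; rewrite ?AX ?XA.
Qed.

Definition centering (R : realType) (n : nat) : 'M[R]_n :=
  1%:M - n%:R^-1 *: const_mx 1.

Lemma tr_centering (R : realType) (n : nat) : (centering R n)^T = centering R n.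
Proof. by rewrite /centering linearB linearZ /= trmx1 trmx_const. Qed.

Lemma tr_bvec (R : realType) (n : nat) (u v : 'I_n) :
  (bvec R u v)^T = delta_mx 0 u - delta_mx 0 v.
Proof. by rewrite linearB /= !trmx_delta. Qed.

(** The coordinates of [b_uv] sum to zero, so the all-ones matrix kills it. *)
Lemma tr_bvec_centering (R : realType) (n : nat) (u v : 'I_n) :
  (bvec R u v)^T *m centering R n = (bvec R u v)^T.
Proof.
rewrite /centering mulmxBr mulmx1 -scalemxAr.
suff -> : (bvec R u v)^T *m (const_mx 1 : 'M_n) = 0 by rewrite scaler0 subr0.
rewrite tr_bvec mulmxBl -!rowE.
by apply/rowP => i; rewrite !mxE subrr.
Qed.

Lemma centering_bvec (R : realType) (n : nat) (u v : 'I_n) :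
  centering R n *m bvec R u v = bvec R u v.
Proof.
by apply: trmx_inj; rewrite trmx_mul tr_centering tr_bvec_centering.
Qed.

Lemma centering_idem (R : realType) (n : nat) :
  (0 < n)%N -> centering R n *m centering R n = centering R n.
Proof.
move=> n0; rewrite {1 3}/centering mulmxBl mul1mx -scalemxAl.
suff -> : (const_mx 1 : 'M[R]_n) *m centering R n = 0 by rewrite scaler0 subr0.
rewrite /centering mulmxBr mulmx1 -scalemxAr; apply/matrixP => i j; rewrite !mxE.
under eq_bigr do rewrite !mxE mulr1.
by rewrite sumr_const card_ord mulVf ?subrr // pnatr_eq0 -lt0n.
Qed.

Lemma laplacian_complete_graphE (R : realType) (n : nat) :
  (0 < n)%N -> laplacian (complete_graph R n) = n%:R *: centering R n.
Proof.
move=> n0; rewrite laplacian_complete_graph scalerBr scale_scalar_mx mulr1.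
by rewrite scalerA mulfV ?scale1r // pnatr_eq0 -lt0n.
Qed.

(** The inner product of [b_uv] and [b_st], expanded into indicators so that bounding it is a finite
    check. *)
Definition bdot (R : realType) (n : nat) (u v s t : 'I_n) : R :=
  (u == s)%:R - (u == t)%:R - (v == s)%:R + (v == t)%:R.

Lemma tr_bvec_bvec (R : realType) (n : nat) (u v s t : 'I_n) :
  (bvec R u v)^T *m bvec R s t = (bdot R u v s t)%:M.
Proof.
rewrite tr_bvec mulmxBl -!rowE.
apply/rowP => i; rewrite !ord1 !mxE eqxx !andbT mulr1n /bdot; ring.
Qed.

Lemma bdot_self (R : realType) (n : nat) (s t : 'I_n) :
  s != t -> bdot R s t s t = 2.
Proof.
by move=> st; rewrite /bdot !eqxx (eq_sym t s) (negPf st) /=; ring.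
Qed.

Lemma sqr_bdot_le4 (R : realType) (n : nat) (u v s t : 'I_n) :
  bdot R u v s t ^+ 2 <= 4.
Proof.
(* All sixteen truth assignments, even inconsistent ones, give a value between -2 and 2. *)
rewrite /bdot; do 4 case: (_ == _); rewrite /=; lra.
Qed.

(** * The pseudoinverses of the two Laplacians *)

Lemma pseudoinverse_laplacian_complete_graph (R : realType) (n : nat) :
  (0 < n)%N ->
  pseudoinverse (laplacian (complete_graph R n)) = n%:R^-1 *: centering R n.
Proof.
move=> n0; have n0' : n%:R != 0 :> R by rewrite pnatr_eq0 -lt0n.
rewrite laplacian_complete_graphE //; apply: pseudoinverse_unique.
apply: (@is_pseudoinverse_sym _ _ _ _ (centering R n));
  rewrite ?linearZ /= ?tr_centering // -?scalemxAl -?scalemxAr.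
- by rewrite centering_idem // scalerA mulVf // scale1r.
- by rewrite centering_idem.
- by rewrite centering_idem.
Qed.

Lemma pseudoinverse_laplacian_add_edge (R : realType) (n : nat) (s t : 'I_n) :
  s != t ->
  pseudoinverse (laplacian (add_edge (complete_graph R n) s t)) =
  n%:R^-1 *: (centering R n
              - (n%:R + 2)^-1 *: (bvec R s t *m (bvec R s t)^T)).
Proof.
move=> st; have n0 : (0 < n)%N := leq_ltn_trans (leq0n s) (ltn_ord s).
have n0' : n%:R != 0 :> R by rewrite pnatr_eq0 -lt0n.
have n2 : n%:R + 2 != 0 :> R by rewrite -natrD pnatr_eq0 addn2.
rewrite laplacian_add_edge // laplacian_complete_graphE //.
set B := _ *m _; set P := centering R n.
have PB : P *m B = B by rewrite mulmxA centering_bvec.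
have BP : B *m P = B by rewrite -mulmxA tr_bvec_centering.
have PP : P *m P = P := centering_idem R n0.
have tB : B^T = B by rewrite trmx_mul trmxK.
have BB : B *m B = 2 *: B.
  rewrite mulmxA -(mulmxA (bvec R s t)) tr_bvec_bvec bdot_self //.
  by rewrite mul_mx_scalar -scalemxAl.
have tP : P^T = P := tr_centering R n.
(* Only the relations between [P] and [B] matter now. In [(n P + B)(P - B / (n + 2))] the
   coefficient of [B] is [1 - n / (n + 2) - 2 / (n + 2) = 0], the 2 being the squared norm of
   [b]. *)
clearbody P B.
apply: pseudoinverse_unique; apply: (@is_pseudoinverse_sym _ _ _ _ P) => //.
- by rewrite linearD linearZ /= tP tB.
- by rewrite linearZ linearB linearZ /= tP tB.
- rewrite mulmxDl -!scalemxAl -!scalemxAr !mulmxBr -!scalemxAr PP PB BP BB.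
  apply/matrixP => i j; rewrite !mxE; field.
  by rewrite n0' n2.
- by rewrite mulmxDr -scalemxAr PP PB.
- by rewrite -scalemxAr mulmxBr -scalemxAr PP PB.
Qed.

(** * Effective resistances, the smallest nonzero eigenvalue, and the maximal difference *)

Lemma Reff_diff_add_edge (R : realType) (n : nat) (s t u v : 'I_n) :
  s != t ->
  Reff (complete_graph R n) u v - Reff (add_edge (complete_graph R n) s t) u v
  = bdot R u v s t ^+ 2 / (n%:R * (n%:R + 2)).
Proof.
move=> st; have n0 : (0 < n)%N := leq_ltn_trans (leq0n s) (ltn_ord s).
rewrite /Reff pseudoinverse_laplacian_complete_graph //.
rewrite pseudoinverse_laplacian_add_edge //.
move: (centering R n) => P.
have xb := tr_bvec_bvec R u v s t.
have bx : (bvec R s t)^T *m bvec R u v = (bdot R u v s t)%:M.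
  by rewrite -[LHS]trmxK trmx_mul trmxK xb tr_scalar_mx.
move: (bvec R u v) (bvec R s t) xb bx => x b xb bx.
have subBE (M N : 'M[R]_1) : M 0 0 - (M - N) 0 0 = N 0 0 by rewrite !mxE; ring.
(* The contributions of [P] cancel; the rank-one term leaves the product of the scalars [x^T b] and
   [b^T x]. *)
rewrite scalerBr mulmxBr mulmxBl subBE -!scalemxAr -!scalemxAl !mulmxA xb.
rewrite -mulmxA bx -scalar_mxM !mxE eqxx mulr1n invfM; ring.
Qed.

Lemma lambda_complete_graph (R : realType) (n : nat) :
  (1 < n)%N -> lambda (complete_graph R n) = n%:R.
Proof.
move=> n1; have n0 : (0 < n)%N := ltnW n1.
apply: lambda_unique; rewrite laplacian_complete_graphE //; split.
- pose s := Ordinal n0; pose t := Ordinal n1.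
  (* Eigenvectors are rows here, hence the transpose; any [b_st] with [s != t] is fixed by the
     projection. *)
  apply/eigenvalueP; exists (bvec R s t)^T.
    by rewrite -scalemxAr tr_bvec_centering.
  apply/eqP => /rowP /(_ s); rewrite !mxE !eqxx /= subr0 => /eqP.
  by rewrite oner_eq0.
- by rewrite pnatr_eq0 -lt0n.
move=> b /eigenvalueP [v vL v0] b0.
(* From [b v = n v P] and [P P = P] one gets [b (v P) = b v], and [b] is nonzero. Hence [b v = n v],
   which forces [b = n]. *)
have vP : v *m centering R n = v.
  apply: (scalerI b0).
  by rewrite scalemxAl -vL -mulmxA -scalemxAl centering_idem.
move/eqP: vL; rewrite -scalemxAr vP -subr_eq0 -scalerBl scaler_eq0 (negPf v0) orbF.
by rewrite subr_eq0 => /eqP ->.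
Qed.

Lemma max_Reff_diff_complete_graph (R : realType) (n : nat) (s t : 'I_n) :
  s != t ->
  max_Reff_diff (complete_graph R n) (add_edge (complete_graph R n) s t)
  = 4 / (n%:R * (n%:R + 2)).
Proof.
move=> st; set d := n%:R * (n%:R + 2).
have d0 : 0 <= d^-1 by rewrite invr_ge0 mulr_ge0 // addr_ge0.
have diffE u v : `|Reff (complete_graph R n) u v
    - Reff (add_edge (complete_graph R n) s t) u v| = bdot R u v s t ^+ 2 / d.
  by rewrite Reff_diff_add_edge // ger0_norm // mulr_ge0 // sqr_ge0.
apply/eqP; rewrite eq_le; apply/andP; split.
  apply: (big_ind (fun x => x <= 4 / d)) => [|x y xd yd|p _].
  - by rewrite mulr_ge0.
  - by rewrite ge_max xd yd.
  - by rewrite diffE ler_wpM2r // sqr_bdot_le4.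
(* The bound is attained at the pair [(s, t)], where the inner product is 2. *)
rewrite /max_Reff_diff (bigD1 (s, t)) //= le_max diffE bdot_self //.
by rewrite -natrX lexx.
Qed.

Theorem theorem5p7 (R : realType) (kappa : R) (kappa_gt0 : 0 < kappa) :
  exists c C : R, 0 < c /\ 0 < C /\
  exists N : nat, forall n : nat, (N <= n)%N ->
  exists G G' : wgraph R n,
    [/\ neighboring G G',
        2 + kappa <= lambda G,
        c * (1 / lambda G ^+ 2) <= max_Reff_diff G G' &
        max_Reff_diff G G' <= C * (1 / lambda G ^+ 2)].
Proof.
(* With [lambda = n], the value [4 / (n (n + 2))] is at most [4 / n^2], and at least [2 / n^2] once
   [n >= 2]. The threshold ensures [n >= 2 + kappa], which covers this. *)
exists 2, 4; do 2 split => //; exists (Num.bound (2 + kappa)) => n Nn.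
have kn : 2 + kappa <= n%:R.
  apply: ltW; apply: lt_le_trans (archi_boundP _) _; first by lra.
  by rewrite ler_nat.
have n2 : 2 <= n%:R :> R by lra.
have n1 : (1 < n)%N by rewrite -(ler_nat R).
pose s := Ordinal (ltnW n1); pose t := Ordinal n1; have st : s != t by [].
exists (complete_graph R n), (add_edge (complete_graph R n) s t).
rewrite lambda_complete_graph // max_Reff_diff_complete_graph //.
have x0 : 0 < n%:R ^+ 2 :> R by rewrite exprn_gt0 //; lra.
have d0 : 0 < n%:R * (n%:R + 2) :> R by rewrite mulr_gt0 //; lra.
split; [exact: neighboring_add_edge|by []|..]; rewrite mulrA mulr1.
  rewrite ler_pdivrMr // mulrAC ler_pdivlMr //.
  (* After clearing denominators the gap [4 n^2 - 2 n (n + 2)] is twice this product. *)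
  have : 0 <= (n%:R - 2) * n%:R :> R by rewrite mulr_ge0 // subr_ge0.
  by move: (n%:R : R) => x; lra.
rewrite ler_pdivrMr // mulrAC ler_pdivlMr //.
by move: (n%:R : R) n2 => x x2; lra.
Qed.
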